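(* Let $X$ and $Y$ be metrizable uniform spaces. Then the join $X*Y$ is uniformly homeomorphic to the amalgamated union $CX\times Y\cup_{X\times Y}X\times CY$.
   Context: All quotients carry the quotient uniformity: for a surjection $q\colon Z\to Q$ from a uniform space, this is the finest pre-uniformity on $Q$ making $q$ uniformly continuous (its uniform covers are those covers $C_1$ of $Q$ that belong to a sequence $C_1,C_2,\dots$ of covers such that $\{\mathrm{st}(x,C_{i+1})\mid x\in Q\}$ refines $C_i$ and $q^{-1}(C_i)$ is a uniform cover of $Z$ for each $i$). Here $\mathrm{st}(x,C)$ is the union of the elements of $C$ containing $x$. The join $X*Y$ is the pushout of $X\times Y\times[-1,1]\supset X\times Y\times\{-1,1\}\xrightarrow{\pi}X\sqcup Y$, where $\pi(x,y,-1)=x$ and $\pi(x,y,1)=y$; that is, the quotient of $(X\times Y\times[-1,1])\sqcup X\sqcup Y$ by the equivalence relation generated by $(x,y,-1)\sim x$ and $(x,y,1)\sim y$. The cone is $CX=X*pt$, which may be viewed as the quotient $X\times[0,1]/X\times\{1\}$; $X$ is identified with the image of $X\times\{0\}$. If $g\colon A\to P$ and $h\colon A\to R$ are uniform embeddings with closed images, the amalgamated union $P\cup_A R$ is the quotient of the uniform disjoint union $P\sqcup R$ by the equivalence relation generated by $g(a)\sim h(a)$, $a\in A$. Here $X\times Y$ is embedded in $CX\times Y$ and in $X\times CY$ via the inclusions $X\subset CX$ and $Y\subset CY$. *)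

(* Defs.v *)
From HB Require Import structures.
From Stdlib Require Import Relations.Relation_Definitions Relations.Relation_Operators.
From mathcomp Require Import all_boot all_order all_algebra generic_quotient.
From mathcomp Require Import all_classical all_reals all_analysis.

Set Implicit Arguments.
Unset Strict Implicit.
Unset Printing Implicit Defensive.

Import Order.TTheory GRing.Theory Num.Theory.
Import numFieldNormedType.Exports.

Local Open Scope classical_set_scope.
Local Open Scope ring_scope.
Local Open Scope relation_scope.
Local Open Scope quotient_scope.

(* A uniformType need not be separated (it is a pre-uniform space); a metrizable
   one is, by the second clause. *)
Definition metrizable (R : realType) (X : uniformType) : Prop :=
  exists d : X -> X -> R,
    [/\ forall x, d x x = 0,
        forall x y, d x y = 0 -> x = y,
        forall x y, d x y = d y x,
        forall x y z, d x z <= d x y + d y z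
      & @entourage X = entourage_ (fun x e => [set y | d x y < e])].

Definition unif_homeomorphic (U V : uniformType) : Prop :=
  exists (f : U -> V) (g : V -> U),
    [/\ cancel f g, cancel g f, unif_continuous f & unif_continuous g].

HB.instance Definition _ := hasNbhs.Build unit principal_filter.
HB.instance Definition _ := Discrete_ofNbhs.Build unit erefl.
HB.instance Definition _ := DiscreteUniform_ofNbhs.Build unit.

Section disjoint_union.
Context {U V : uniformType}.

Definition sum_ent : set_system ((U + V) * (U + V)) :=
  [set E | entourage [set xy : U * U | E (inl xy.1, inl xy.2)] /\
           entourage [set xy : V * V | E (inr xy.1, inr xy.2)]].

Let sum_ent_filter : Filter sum_ent.
Proof.
split; first by split; apply: filterT.
- by move=> A B [A1 A2] [B1 B2]; split; apply: filterI.
- move=> A B AB [A1 A2]; split.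
  + by apply: filterS A1 => xy; exact: AB.
  + by apply: filterS A2 => xy; exact: AB.
Qed.

Let sum_ent_diagonal A : sum_ent A -> diagonal `<=` A.
Proof.
by move=> [A1 A2] [u v] /diagonalP <-; case: u => x;
  [exact: (entourage_refl _ A1)|exact: (entourage_refl _ A2)].
Qed.

Let sum_ent_inv A : sum_ent A -> sum_ent A^-1.
Proof. by move=> [/entourage_inv A1 /entourage_inv A2]; split. Qed.

Let sum_ent_split A : sum_ent A -> exists2 B, sum_ent B & B \; B `<=` A.
Proof.
move=> [/entourage_split_ex[B1 e1 s1] /entourage_split_ex[B2 e2 s2]].
exists [set uv : (U + V) * (U + V) | match uv with
  | (inl x, inl y) => B1 (x, y) | (inr x, inr y) => B2 (x, y)
  | _ => False end].
  by split; [apply: filterS e1|apply: filterS e2] => -[].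
move=> [[x|x] [z|z]] [[y|y]] //= p q.
- by apply: (s1 (x, z)); exists y.
- by apply: (s2 (x, z)); exists y.
Qed.

HB.instance Definition _ := isUniform.Build (U + V)%type
  sum_ent_filter sum_ent_diagonal sum_ent_inv sum_ent_split.

End disjoint_union.

(* Alias of a quotient type carrying the quotient uniformity; its topology may
   be coarser than the one of quotient_topology. *)
Definition quotient_uniformity (T : Type) (Q : quotType T) : Type := Q.

Section quotient_uniformity.
Context {T : uniformType} {Q0 : quotType T}.
Local Notation Q := (quotient_uniformity Q0).

HB.instance Definition _ := Quotient.copy Q Q0.
HB.instance Definition _ := [Sub Q of T by %/].
HB.instance Definition _ := [Choice of Q by <:].

(* The entourage form of the description of the uniform covers of a quotient by
   sequences of covers; see quotient_unif_coverP for the latter, and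
   quotient_unif_continuous for the fact that this is the finest uniformity
   making the projection uniformly continuous. *)
Definition quotient_ent : set_system (Q * Q) :=
  [set E | exists W : nat -> set (Q * Q),
    [/\ W 0%N = E,
        forall n, W n.+1 \; W n.+1 `<=` W n
      & forall n, entourage [set xy : T * T | W n (\pi_Q xy.1, \pi_Q xy.2)]]].

Let quotient_ent_filter : Filter quotient_ent.
Proof.
split.
- exists (fun=> setT); split=> // n.
  by apply: filterS (@entourageT T).
- move=> A B [W [<- W1 W2]] [W' [<- W'1 W'2]].
  exists (fun n => W n `&` W' n); split=> //.
  + move=> n [x z] [y [a a'] [b b']].
    by split; [apply: W1|apply: W'1]; exists y.
  + by move=> n; exact: (filterI (W2 n) (W'2 n)).
- move=> A B AB [W [WA W1 W2]].
  exists (fun n => if n is 0%N then B else W n); split=> //.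
  + by move=> [|n]; last exact: W1; apply: subset_trans AB; rewrite -WA; exact: W1.
  + move=> [|n]; last exact: W2.
    by apply: filterS (W2 0%N) => xy; rewrite WA; exact: AB.
Qed.

Let quotient_ent_diagonal A : quotient_ent A -> diagonal `<=` A.
Proof.
move=> [W [<- _ W2]] [u v] /diagonalP <-.
by rewrite -[u]reprK; exact: (entourage_refl (repr u) (W2 0%N)).
Qed.

Let quotient_ent_inv A : quotient_ent A -> quotient_ent A^-1.
Proof.
move=> [W [<- W1 W2]]; exists (fun n => (W n)^-1); split=> //.
- by move=> n [x z] [y a b]; apply: (W1 n (z, x)); exists y.
- by move=> n; exact: (entourage_inv (W2 n)).
Qed.

Let quotient_ent_split A :
  quotient_ent A -> exists2 B, quotient_ent B & B \; B `<=` A.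
Proof.
move=> [W [<- W1 W2]]; exists (W 1%N); last exact: W1.
by exists (fun n => W n.+1); split.
Qed.

HB.instance Definition _ := isUniform.Build Q
  quotient_ent_filter quotient_ent_diagonal quotient_ent_inv quotient_ent_split.

Lemma pi_unif_continuous : unif_continuous (\pi_Q : T -> Q).
Proof. by move=> E [W [<- _ W2]]; exact: W2. Qed.

Lemma quotient_unif_continuous (V : uniformType) (f : Q -> V) :
  unif_continuous f <-> unif_continuous (f \o \pi_Q).
Proof.
split=> [cf E /cf|cf E entE].
  exact: pi_unif_continuous.
pose S := fix S n := if n is m.+1 then split_ent (S m) else E.
have entS n : entourage (S n) by elim: n => //= n; exact: entourage_split_ent.
exists (fun n => [set xy | S n (f xy.1, f xy.2)]); split=> //.
- move=> n [x z] [y a b]; apply: (subset_split_ent (entS n)).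
  by exists (f y).
- by move=> n; exact: (cf _ (entS n)).
Qed.

End quotient_uniformity.

Definition unif_cover (U : uniformType) (C : set_system U) : Prop :=
  exists2 E, entourage E &
    forall x, exists2 A, C A & [set y | E (x, y)] `<=` A.

Definition star (U : Type) (x : U) (C : set_system U) : set U :=
  \bigcup_(A in [set A | C A /\ A x]) A.

Lemma quotient_unif_coverP (T : uniformType) (Q0 : quotType T)
    (C : set_system (quotient_uniformity Q0)) :
  unif_cover C <->
  exists D : nat -> set_system (quotient_uniformity Q0),
    [/\ D 0%N = C,
        forall n x, exists2 A, D n A & star x (D n.+1) `<=` A
      & forall n, unif_cover
          [set \pi_(quotient_uniformity Q0) @^-1` A | A in D n]].
Proof.
set Q := quotient_uniformity Q0; split.
  move=> [E [W [<- W1 W2]] EC].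
  pose V n := W n `&` (W n)^-1.
  have VV n x y z : V n.+1 (y, x) -> V n.+1 (y, z) -> V n (x, z).
    move=> [a a'] [b b']; split; first by apply: (W1 n); exists y.
    by apply: (W1 n (z, x)); exists y.
  have entV n : entourage [set xy : T * T | V n (\pi_Q xy.1, \pi_Q xy.2)].
    by apply: filterI; [exact: W2|exact: (entourage_inv (W2 n))].
  exists (fun n => if n is m.+1 then range (fun x => [set y | V n (x, y)]) else C).
  split=> //.
  - move=> n x.
    have sV : star x (range (fun x => [set y | V n.+1 (x, y)]))
        `<=` [set y | V n (x, y)].
      by move=> z [_ [[y _ <-] /= yx] /= yz]; exact: VV yx yz.
    case: n sV => [|n] sV.
      by have [A CA sA] := EC x; exists A => // y /sV [xy _]; exact: sA.
    by exists [set y | V n.+1 (x, y)] => //; exists x.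
  - move=> n; exists [set xy : T * T | V n (\pi_Q xy.1, \pi_Q xy.2)] => // x.
    case: n => [|n].
      have [A CA sA] := EC (\pi_Q x).
      by exists (\pi_Q @^-1` A); [exists A|move=> y [xy _]; exact: sA].
    exists (\pi_Q @^-1` [set y | V n.+1 (\pi_Q x, y)]) => //.
    by exists [set y | V n.+1 (\pi_Q x, y)] => //; exists (\pi_Q x).
move=> [D [<- D1 D2]].
pose W n : set (Q * Q) := [set xy | exists A, [/\ D n.+1 A, A xy.1 & A xy.2]].
exists (W 0%N).
  exists W; split=> //.
  - move=> n [x z] [y [A [DA Ax Ay]] [B [DB By Bz]]].
    have [A' DA' sA'] := D1 n.+1 y.
    by exists A'; split=> //; apply: sA'; [exists A|exists B].
  - move=> n; have [E entE ED] := D2 n.+1.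
    apply: (filterS _ entE) => -[x y] Exy.
    have [_ [A DA <-] sA] := ED x.
    exists A; split; [exact: DA| |exact: (sA y Exy)].
    by apply: (sA x); exact: (entourage_refl x entE).
move=> x; have [A DA sA] := D1 0%N x; exists A => //.
by move=> y [B [DB Bx By]]; apply: sA; exists B.
Qed.

Section generated_equivalence.
Context {T : choiceType} (r : relation T).

Definition gen_eqv : rel T := fun x y => `[< clos_refl_sym_trans T r x y >].

Let gen_eqv_refl : reflexive gen_eqv.
Proof. by move=> x; apply/asboolP; exact: rst_refl. Qed.

Let gen_eqv_sym : symmetric gen_eqv.
Proof.
by move=> x y; apply/asboolP/asboolP; exact: rst_sym.
Qed.

Let gen_eqv_trans : transitive gen_eqv.
Proof.
by move=> y x z /asboolP xy /asboolP yz; apply/asboolP; exact: rst_trans xy yz.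
Qed.

Definition gen_equiv : equiv_rel T :=
  EquivRel gen_eqv gen_eqv_refl gen_eqv_sym gen_eqv_trans.

End generated_equivalence.

Definition unif_quotient (Z : uniformType) (r : relation Z) : uniformType :=
  quotient_uniformity {eq_quot gen_equiv r}.

Definition unif_proj (Z : uniformType) (r : relation Z) (z : Z) :
    unif_quotient r :=
  \pi_(quotient_uniformity {eq_quot gen_equiv r}) z.

Definition segment (R : realType) : uniformType := set_type `[(-1 : R), 1]%classic.

Inductive join_rel (R : realType) (X Y : uniformType) :
    relation ((X * Y * segment R) + (X + Y)) :=
| join_left x y (t : segment R) : set_val t = -1 ->
    join_rel (inl (x, y, t)) (inr (inl x))
| join_right x y (t : segment R) : set_val t = 1 ->
    join_rel (inl (x, y, t)) (inr (inr y)).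

Definition join (R : realType) (X Y : uniformType) : uniformType :=
  unif_quotient (@join_rel R X Y).

Definition cone (R : realType) (X : uniformType) : uniformType := join R X unit.

(* The base X x {0} of X x [0,1] / X x {1} is the end t = -1 of the join. *)
Definition cone_base (R : realType) (X : uniformType) (x : X) : cone R X :=
  unif_proj (@join_rel R X unit) (inr (inl x)).

Inductive amalgam_rel (A P S : uniformType) (g : A -> P) (h : A -> S) :
    relation (P + S) :=
| amalgam_glue a : amalgam_rel g h (inl (g a)) (inr (h a)).

Definition amalgam (A P S : uniformType) (g : A -> P) (h : A -> S) :
    uniformType :=
  unif_quotient (amalgam_rel g h).

(* Main.v *)
Require Import Defs.
From mathcomp Require Import all_boot all_order all_algebra.
From mathcomp Require Import all_classical all_reals all_analysis.
From mathcomp Require Import generic_quotient lra.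
From Stdlib Require Import Relations.Relation_Definitions.
From Stdlib Require Import Relations.Relation_Operators.

(** Cut the join at height 0.  For t <= 0 the point (x, y, t) is sent to
    (x, [y, -1 - 2 t]) in X * CY, and for t >= 0 to ([x, 2 t - 1], y) in CX * Y.
    The end t = -1, where Y is collapsed, goes to X * {apex of CY}; the end
    t = 1, where X is collapsed, goes to {apex of CX} * Y; at t = 0 both
    formulas give the point (x, y) of the common subspace X * Y.  Undoing the
    two affine reparametrizations gives the inverse map, so the whole content
    is the uniform continuity of the two maps.

    Out of the join, the universal property of the quotient uniformity reduces
    the question to X * Y * [-1,1], where the two formulas can be glued along
    t = 0: if each formula is continued by its value at t = 0, both become
    uniformly continuous everywhere, and a pair of close points on opposite
    sides of the cut is compared through the common continuation
    ([glue_unif_continuous]).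

    Out of the amalgam, the universal property reduces the question to CX * Y
    and X * CY.  The uniformity of CX * Y is that of a product, while CX itself
    is a quotient; the key point is that the product of a uniform quotient with
    an identity map is again a uniform quotient
    ([prod_quotient_unif_continuous]).  Granting this, a map on CX * Y is
    uniformly continuous as soon as it is so in the coordinates (x, s, y) and
    on the apex ([cone_prod_unif_continuous]), where it is given by an explicit
    formula. *)

Import Order.TTheory GRing.Theory Num.Theory.
Local Open Scope classical_set_scope.
Local Open Scope ring_scope.
Local Open Scope relation_scope.
Local Open Scope quotient_scope.

Set Implicit Arguments.
Unset Strict Implicit.
Unset Printing Implicit Defensive.

(** * Uniformly continuous maps *)

Section unif_continuity.
Context {U V W : uniformType}.

Lemma prod_entourageP (E : set ((U * V) * (U * V))) : entourage E ->
  exists A B, [/\ entourage A, entourage B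
    & forall u v u' v', A (u, u') -> B (v, v') -> E ((u, v), (u', v'))].
Proof.
move=> [[A B] [entA entB] sAB]; exists A, B; split=> // u v u' v' Au Bv.
have /sAB [[[a b] [c d]] /= Eabcd [<- <- <- <-]] :
  (A `*` B) ((u, u'), (v, v')) by [].
exact: Eabcd.
Qed.

Lemma unif_continuous_preimage (f : U -> V) (E : set (V * V)) :
  unif_continuous f -> entourage E ->
  entourage [set xy | E (f xy.1, f xy.2)].
Proof. by move=> cf /cf. Qed.

Lemma eq_unif_continuous (f g : U -> V) :
  f =1 g -> unif_continuous f -> unif_continuous g.
Proof. by move=> /funext ->. Qed.

Lemma unif_continuous_comp (f : U -> V) (g : V -> W) :
  unif_continuous f -> unif_continuous g -> unif_continuous (fun x => g (f x)).
Proof. by move=> cf cg E /cg /cf. Qed.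

End unif_continuity.

Section products_and_sums.
Context {U V W : uniformType}.

Lemma unif_continuous_pair (f : W -> U) (g : W -> V) :
  unif_continuous f -> unif_continuous g ->
  unif_continuous (fun x => (f x, g x)).
Proof.
move=> cf cg E /prod_entourageP [A [B [entA entB sAB]]].
have fA := unif_continuous_preimage cf entA.
have gB := unif_continuous_preimage cg entB.
by apply: filterS (filterI fA gB) => -[x y] /= []; exact: sAB.
Qed.

Lemma unif_continuous_id : unif_continuous (fun x : U => x).
Proof. by move=> E entE; apply: filterS entE => -[]. Qed.

Lemma unif_continuous_cst (v : V) : unif_continuous (fun _ : U => v).
Proof.
move=> E entE; apply: filterS entourageT => -[x y] _; exact: entourage_refl.
Qed.

Lemma unif_continuous_fst (f : W -> U * V) :
  unif_continuous f -> unif_continuous (fun x => (f x).1).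
Proof.
move=> cf E entE; apply: (cf [set xy | E (xy.1.1, xy.2.1)]).
by apply: filterS (prod_entP entE (@entourageT V)) => xy [].
Qed.

Lemma unif_continuous_snd (f : W -> U * V) :
  unif_continuous f -> unif_continuous (fun x => (f x).2).
Proof.
move=> cf E entE; apply: (cf [set xy | E (xy.1.2, xy.2.2)]).
by apply: filterS (prod_entP (@entourageT U) entE) => xy [].
Qed.

Lemma unif_continuous_inl : unif_continuous (inl : U -> U + V).
Proof. by move=> E []. Qed.

Lemma unif_continuous_inr : unif_continuous (inr : V -> U + V).
Proof. by move=> E []. Qed.

Lemma sum_unif_continuous (f : U + V -> W) :
  unif_continuous (f \o inl) -> unif_continuous (f \o inr) ->
  unif_continuous f.
Proof. by move=> cl cr E entE; split; [exact: cl|exact: cr]. Qed.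

(** Since both f and g are defined on the whole of U, no distance estimate
    across the boundary of P is needed: if x is in P and y is not, then
    f x is close to f y = b y, which is close to b x = g x, which is close
    to g y. *)
Lemma glue_unif_continuous (P : pred U) (f g b : U -> V) :
  unif_continuous f -> unif_continuous g -> unif_continuous b ->
  (forall x, P x -> g x = b x) -> (forall x, ~~ P x -> f x = b x) ->
  unif_continuous (fun x => if P x then f x else g x).
Proof.
move=> cf cg cb gb fb E entE.
have entS1 := entourage_split_ent entE.
have entS := entourage_split_ent entS1.
set S := split_ent _ in entS.
have chain x y z t : S (x, y) -> S (y, z) -> S (z, t) -> E (x, t).
  move=> xy yz zt; apply: (entourage_split z entE).
    exact: (entourage_split y entS1).
  exact: (split_ent_subset entS1).
have fS := unif_continuous_preimage cf entS.
have gS := unif_continuous_preimage cg entS.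
have bS := unif_continuous_preimage cb (entourage_inv entS).
apply: filterS (filterI (filterI fS gS) bS).
move=> [x y] /= [[Sf Sg] Sb].
have Sfg : S (f x, f y) /\ S (g x, g y) by [].
case: (boolP (P x)) (boolP (P y)) => Px [] Py.
- exact/(split_ent_subset entE)/(split_ent_subset entS1).
- apply: (chain _ (f y) (g x)) => //; rewrite gb ?fb //.
- apply: (chain _ (g y) (f x)) => //; rewrite gb ?fb //.
- exact/(split_ent_subset entE)/(split_ent_subset entS1).
Qed.

End products_and_sums.

Lemma prod_sum_unif_continuous (U V W Y : uniformType) (f : (U + V) * Y -> W) :
  unif_continuous (fun uy : U * Y => f (inl uy.1, uy.2)) ->
  unif_continuous (fun vy : V * Y => f (inr vy.1, vy.2)) ->
  unif_continuous f.
Proof.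
move=> cl cr E entE.
have [A [B [entA entB sAB]]] := prod_entourageP (cl _ entE).
have [A' [B' [entA' entB' sAB']]] := prod_entourageP (cr _ entE).
pose S := [set uv : (U + V) * (U + V) | match uv with
  | (inl x, inl y) => A (x, y) | (inr x, inr y) => A' (x, y)
  | _ => False end].
have entS : entourage S.
  by split; [apply: filterS entA|apply: filterS entA'] => -[].
apply: filterS (prod_entP entS (filterI entB entB')).
move=> [[[u|v] y] [[u'|v'] y']] [/= S12 [By B'y]] //.
- exact: (sAB _ _ _ _ S12 By).
- exact: (sAB' _ _ _ _ S12 B'y).
Qed.

(** The product of a uniform quotient map with an identity map is again a
    uniform quotient map.  The reason is currying: p |-> f (p, -) is a map from
    the quotient to the functions on Y with the uniformity of uniform
    convergence, so it may be tested on T, where it is uniformly continuous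
    because f is so on T * Y.  Hence f (p, y) and f (q, y) are close for all y
    at once; and f (q, y) and f (q, y') are close, uniformly in q, because q
    can be lifted to T. *)
Lemma prod_quotient_unif_continuous (T Y V : uniformType) (Q0 : quotType T)
    (f : quotient_uniformity Q0 * Y -> V) :
  unif_continuous (fun zy : T * Y =>
    f (\pi_(quotient_uniformity Q0) zy.1, zy.2)) ->
  unif_continuous f.
Proof.
set Q := quotient_uniformity Q0 => cf E entE.
pose S := fix S n := if n is m.+1 then split_ent (S m) else split_ent E.
have entS n : entourage (S n) by elim: n => [|n] /=; exact: entourage_split_ent.
pose W n := [set pq : Q * Q | forall y, S n (f (pq.1, y), f (pq.2, y))].
(* W is the pullback of uniform closeness of functions on Y. *)
have entW : entourage (W 0%N).
  exists W; split=> // n.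
    move=> [p q] [r Wpr Wrq] y.
    exact: (entourage_split _ (entS n) (Wpr y) (Wrq y)).
  have [A [B [entA entB sAB]]] := prod_entourageP (cf _ (entS n)).
  apply: filterS entA => -[z w] Azw y.
  by apply: sAB Azw _; exact: entourage_refl.
have [A [B [entA entB sAB]]] := prod_entourageP (cf _ (entS 0%N)).
apply: filterS (prod_entP entW entB) => -[[p y] [q y']] [/= Wpq Byy'].
apply: (entourage_split _ entE (Wpq y)).
have := sAB (repr q) y (repr q) y' (entourage_refl _ entA) Byy'.
by rewrite /= reprK.
Qed.

(** * Maps out of a uniform quotient *)

Section unif_quotient_lift.
Context {Z V : uniformType} {r : relation Z}.

Lemma unif_proj_surj (p : unif_quotient r) : exists z, p = unif_proj r z.
Proof. by exists (repr p); rewrite /unif_proj reprK. Qed.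

Lemma unif_proj_rel z w : r z w -> unif_proj r z = unif_proj r w.
Proof.
by move=> rzw; apply/eqmodP/asboolP; exact: rst_step.
Qed.

(** Evaluation at a representative; it is the induced map on the quotient only
    when F respects the generating relation. *)
Definition unif_lift (F : Z -> V) (p : unif_quotient r) : V := F (repr p).

Hypothesis (F : Z -> V) (rF : forall z w, r z w -> F z = F w).

Lemma unif_liftE z : unif_lift F (unif_proj r z) = F z.
Proof.
have /eqmodP /asboolP : \pi_(quotient_uniformity {eq_quot gen_equiv r})
    (repr (unif_proj r z)) = unif_proj r z by rewrite reprK.
rewrite /unif_lift; move: (repr _) => w.
by elim=> // x y z' _ -> _ ->.
Qed.

Lemma unif_lift_continuous : unif_continuous F -> unif_continuous (unif_lift F).
Proof.
move=> cF; apply/quotient_unif_continuous.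
by rewrite (_ : _ \o _ = F) //; apply/funext => z; exact: unif_liftE.
Qed.

End unif_quotient_lift.

Lemma unif_proj_continuous (Z : uniformType) (r : relation Z) :
  unif_continuous (unif_proj r).
Proof. exact: pi_unif_continuous. Qed.

(** * Reparametrizations of the segment *)

Section segment.
Context {R : realType}.

Lemma clamp_subproof (r : R) :
  Num.max (-1) (Num.min 1 r) \in (`[(-1 : R), 1]%classic : set R).
Proof.
rewrite inE /= in_itv /= le_max lexx /= ge_max ge_min lexx /= andbT.
lra.
Qed.

(** The retraction of the line onto [-1,1].  It lets affine formulas be used on
    the whole segment: beyond the cut, the reparametrized height stays at the
    base of the cone. *)
Definition clamp (r : R) : segment R :=
  exist (fun x => x \in `[(-1 : R), 1]%classic) _ (clamp_subproof r).

Lemma segment_bounds (t : segment R) : -1 <= set_val t <= 1.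
Proof. by have := set_valP t; rewrite /= in_itv. Qed.

Lemma val_clampE (r : R) : set_val (clamp r) = Num.max (-1) (Num.min 1 r).
Proof. by []. Qed.

Lemma val_clamp (r : R) : -1 <= r <= 1 -> set_val (clamp r) = r.
Proof.
by move=> /andP[r0 r1]; rewrite val_clampE (min_idPr r1) (max_idPr r0).
Qed.

Lemma clamp_val (t : segment R) : clamp (set_val t) = t.
Proof. by apply: val_inj; exact: val_clamp (segment_bounds t). Qed.

Lemma clamp_le (r : R) : r <= -1 -> clamp r = clamp (-1).
Proof.
move=> r0; apply: val_inj => /=.
rewrite (min_idPr _) ?(max_idPl _) //; last lra.
rewrite (min_idPr _) ?(max_idPl _) //; lra.
Qed.

Lemma clamp_dist (r s : R) :
  `|set_val (clamp r) - set_val (clamp s)| <= `|r - s|.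
Proof.
have clampE u : [\/ u <= -1 /\ set_val (clamp u) = -1,
    1 <= u /\ set_val (clamp u) = 1
  | -1 <= u <= 1 /\ set_val (clamp u) = u].
  rewrite val_clampE; case: (lerP 1 u) => u1.
    by constructor 2; split=> //; rewrite max_r; lra.
  by case: (lerP u (-1)) => u0; [constructor 1|constructor 3]; split=> //; lra.
have := ler_norm (r - s); have := ler_norm (s - r).
rewrite (distrC s) ler_norml.
by case: (clampE r) (clampE s) => -[? ->] [] [? ->]; lra.
Qed.

Lemma clamp_affine_unif_continuous (a b : R) :
  unif_continuous (fun t : segment R => clamp (a * set_val t + b)).
Proof.
move=> E [D entD sDE].
have [e /= e0 be] :
    exists2 e : R, 0 < e & forall r s : R, `|r - s| < e -> D (r, s).
  have : entourage_ (@ball R R^o) D by rewrite entourage_ballE; exact: entD.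
  move=> [e e0 be].
  by exists e => // r s rs; exact: be.
(* The 1 keeps the denominator positive when a = 0. *)
pose d := e / (`|a| + 1).
exists [set rs : R * R | `|rs.1 - rs.2| < d].
  suff : entourage_ (@ball R R^o) [set rs : R * R | `|rs.1 - rs.2| < d].
    by rewrite entourage_ballE.
  exists d => //=; rewrite divr_gt0 //; have := normr_ge0 a; lra.
move=> [s t] /=; rewrite ltr_pdivlMr; last by have := normr_ge0 a; lra.
move=> std; apply: sDE; apply: be => /=.
apply: le_lt_trans (clamp_dist _ _) _.
rewrite opprD addrACA subrr addr0 -mulrBr normrM; apply: le_lt_trans std.
by have := normr_ge0 (set_val s - set_val t); lra.
Qed.

End segment.

Ltac unif_cont_proj :=
  repeat first [exact: unif_continuous_id | apply: unif_continuous_pair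
    | apply: unif_continuous_fst | apply: unif_continuous_snd].

(** * Joins *)

Section join.
Context {R : realType} {X Y V : uniformType}.

Definition join_pt (x : X) (y : Y) (t : segment R) : join R X Y :=
  unif_proj (@join_rel R X Y) (inl (x, y, t)).
Definition join_inl (x : X) : join R X Y :=
  unif_proj (@join_rel R X Y) (inr (inl x)).
Definition join_inr (y : Y) : join R X Y :=
  unif_proj (@join_rel R X Y) (inr (inr y)).

Lemma join_pt_inl x y (t : segment R) :
  set_val t = -1 -> join_pt x y t = join_inl x.
Proof. by move=> t1; apply: unif_proj_rel; constructor. Qed.

Lemma join_pt_inr x y (t : segment R) :
  set_val t = 1 -> join_pt x y t = join_inr y.
Proof. by move=> t1; apply: unif_proj_rel; constructor. Qed.

Lemma join_ind (P : join R X Y -> Prop) :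
  (forall x y t, P (join_pt x y t)) -> (forall x, P (join_inl x)) ->
  (forall y, P (join_inr y)) -> forall p, P p.
Proof.
move=> Ppt Pl Pr p; have [z ->] := unif_proj_surj p.
by case: z => [[[x y] t]|[x|y]]; [exact: Ppt|exact: Pl|exact: Pr].
Qed.

Lemma join_pt_continuous (W : uniformType) (f : W -> X) (g : W -> Y)
    (t : W -> segment R) :
  unif_continuous f -> unif_continuous g -> unif_continuous t ->
  unif_continuous (fun w => join_pt (f w) (g w) (t w)).
Proof.
move=> cf cg ct.
have cfgt : unif_continuous (fun w => ((f w, g w), t w)).
  by apply: unif_continuous_pair => //; exact: unif_continuous_pair.
exact: (unif_continuous_comp (unif_continuous_comp cfgt unif_continuous_inl)
  (unif_proj_continuous (r := @join_rel R X Y))).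
Qed.

Lemma join_inl_continuous : unif_continuous join_inl.
Proof.
apply: (@unif_continuous_comp _ _ _ (inr \o inl));
  last exact: unif_proj_continuous.
exact: (unif_continuous_comp unif_continuous_inl unif_continuous_inr).
Qed.

Lemma join_inr_continuous : unif_continuous join_inr.
Proof.
apply: (@unif_continuous_comp _ _ _ (inr \o inr));
  last exact: unif_proj_continuous.
exact: (unif_continuous_comp unif_continuous_inr unif_continuous_inr).
Qed.

Definition join_rec (F : X -> Y -> segment R -> V) (l : X -> V) (r : Y -> V) :
    join R X Y -> V :=
  unif_lift (fun z => match z with
    | inl w => F w.1.1 w.1.2 w.2 | inr (inl x) => l x | inr (inr y) => r y
    end).

Section join_rec.
Variables (F : X -> Y -> segment R -> V) (l : X -> V) (r : Y -> V).
Hypothesis Fl : forall x y t, set_val t = -1 -> F x y t = l x.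
Hypothesis Fr : forall x y t, set_val t = 1 -> F x y t = r y.

Let compat z w : @join_rel R X Y z w ->
  match z with
  | inl w => F w.1.1 w.1.2 w.2 | inr (inl x) => l x | inr (inr y) => r y
  end =
  match w with
  | inl w => F w.1.1 w.1.2 w.2 | inr (inl x) => l x | inr (inr y) => r y
  end.
Proof. by case=> x y t t1 /=; [exact: Fl|exact: Fr]. Qed.

Lemma join_rec_pt x y t : join_rec F l r (join_pt x y t) = F x y t.
Proof. by rewrite [LHS](unif_liftE compat). Qed.

Lemma join_rec_inl x : join_rec F l r (join_inl x) = l x.
Proof. by rewrite [LHS](unif_liftE compat). Qed.

Lemma join_rec_inr y : join_rec F l r (join_inr y) = r y.
Proof. by rewrite [LHS](unif_liftE compat). Qed.

Lemma join_rec_continuous :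
  unif_continuous (fun w : X * Y * segment R => F w.1.1 w.1.2 w.2) ->
  unif_continuous l -> unif_continuous r -> unif_continuous (join_rec F l r).
Proof.
move=> cF cl cr; apply: (unif_lift_continuous compat).
by apply: sum_unif_continuous => //; apply: sum_unif_continuous.
Qed.

End join_rec.
End join.

Arguments join_inl {R X Y} x.
Arguments join_inr {R X Y} y.

(** * Cones *)

Section cone.
Context {R : realType} {X : uniformType}.

Definition cone_pt (x : X) (t : segment R) : cone R X := join_pt x tt t.
Definition cone_apex : cone R X := join_inr tt.

Lemma cone_pt_base x t : set_val t = -1 -> cone_pt x t = cone_base R x.
Proof. exact: join_pt_inl. Qed.

Lemma cone_pt_apex x t : set_val t = 1 -> cone_pt x t = cone_apex.
Proof. exact: join_pt_inr. Qed.

Lemma cone_pt_clampN1 x : cone_pt x (clamp (-1)) = cone_base R x.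
Proof. by apply: cone_pt_base; rewrite val_clamp //; lra. Qed.

Lemma cone_cases (p : cone R X) :
  (exists x t, p = cone_pt x t) \/ p = cone_apex.
Proof.
move: p; apply: join_ind => [x [] t|x|[]]; last by right.
- by left; exists x, t.
- by left; exists x, (clamp (-1)); rewrite cone_pt_clampN1.
Qed.

Lemma cone_pt_continuous (W : uniformType) (f : W -> X) (t : W -> segment R) :
  unif_continuous f -> unif_continuous t ->
  unif_continuous (fun w => cone_pt (f w) (t w)).
Proof.
by move=> cf ct; apply: join_pt_continuous => //; exact: unif_continuous_cst.
Qed.

(** CX * Y is a quotient of (X * [-1,1] * Y) + Y: the base X of CX adds no
    condition, since its points are also the points of height -1. *)
Lemma cone_prod_unif_continuous (Y V : uniformType) (f : cone R X * Y -> V) :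
  unif_continuous (fun w : X * segment R * Y => f (cone_pt w.1.1 w.1.2, w.2)) ->
  unif_continuous (fun y => f (cone_apex, y)) ->
  unif_continuous f.
Proof.
move=> cf ca; apply: prod_quotient_unif_continuous.
apply: prod_sum_unif_continuous; last apply: prod_sum_unif_continuous.
- apply: eq_unif_continuous (unif_continuous_comp
    (f := fun w : X * unit * segment R * Y => ((w.1.1.1, w.1.2), w.2)) _ cf).
    by move=> [[[x []] t] y].
  by unif_cont_proj.
- apply: eq_unif_continuous (unif_continuous_comp
    (f := fun w : X * Y => ((w.1, clamp (-1)), w.2)) _ cf).
    by move=> [x y] /=; rewrite cone_pt_clampN1.
  by unif_cont_proj; exact: unif_continuous_cst.
- apply: eq_unif_continuous (unif_continuous_comp (f := snd) _ ca).
    by move=> [[] y].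
  by unif_cont_proj.
Qed.

End cone.

(** * The join and the amalgamated union *)

Section join_amalgam.
Context {R : realType} {X Y : uniformType}.

Local Notation glue := (@amalgam_rel (X * Y)%type (cone R X * Y)%type
  (X * cone R Y)%type (fun xy : X * Y => (cone_base R xy.1, xy.2))
  (fun xy : X * Y => (xy.1, cone_base R xy.2))).
Local Notation A := (@amalgam (X * Y)%type (cone R X * Y)%type
  (X * cone R Y)%type (fun xy : X * Y => (cone_base R xy.1, xy.2))
  (fun xy : X * Y => (xy.1, cone_base R xy.2))).

Definition amalgam_inl (p : cone R X * Y) : A := unif_proj glue (inl p).
Definition amalgam_inr (q : X * cone R Y) : A := unif_proj glue (inr q).

Lemma amalgam_base x y :
  amalgam_inl (cone_base R x, y) = amalgam_inr (x, cone_base R y).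
Proof. by apply: unif_proj_rel; exact: (amalgam_glue _ _ (x, y)). Qed.

Lemma amalgam_inl_continuous : unif_continuous amalgam_inl.
Proof.
exact: (unif_continuous_comp unif_continuous_inl
  (unif_proj_continuous (r := glue))).
Qed.

Lemma amalgam_inr_continuous : unif_continuous amalgam_inr.
Proof.
exact: (unif_continuous_comp unif_continuous_inr
  (unif_proj_continuous (r := glue))).
Qed.

Definition join_to_amalgam_pt (x : X) (y : Y) (t : segment R) : A :=
  if set_val t <= 0
  then amalgam_inr (x, cone_pt y (clamp (- 2 * set_val t + -1)))
  else amalgam_inl (cone_pt x (clamp (2 * set_val t + -1)), y).

Definition join_to_amalgam : join R X Y -> A :=
  join_rec join_to_amalgam_pt (fun x => amalgam_inr (x, cone_apex))
    (fun y => amalgam_inl (cone_apex, y)).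

Lemma join_to_amalgam_pt_inl x y t :
  set_val t = -1 -> join_to_amalgam_pt x y t = amalgam_inr (x, cone_apex).
Proof.
rewrite /join_to_amalgam_pt => ->; rewrite ifT; last lra.
by rewrite cone_pt_apex // val_clamp; lra.
Qed.

Lemma join_to_amalgam_pt_inr x y t :
  set_val t = 1 -> join_to_amalgam_pt x y t = amalgam_inl (cone_apex, y).
Proof.
rewrite /join_to_amalgam_pt => ->; rewrite ifF; last lra.
by rewrite cone_pt_apex // val_clamp; lra.
Qed.

Lemma join_to_amalgam_continuous : unif_continuous join_to_amalgam.
Proof.
apply: (join_rec_continuous join_to_amalgam_pt_inl join_to_amalgam_pt_inr).
- have clampC (a b : R) : unif_continuous
      (fun w : X * Y * segment R => clamp (a * set_val w.2 + b)).
    apply: (unif_continuous_comp _ (clamp_affine_unif_continuous a b)).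
    by unif_cont_proj.
  (* Past height 0 both formulas are constantly at the base X * Y. *)
  apply: (@glue_unif_continuous _ _
    (fun w : X * Y * segment R => set_val w.2 <= 0)
    _ _ (fun w => amalgam_inl (cone_base R w.1.1, w.1.2))).
  + apply: (unif_continuous_comp _ amalgam_inr_continuous).
    apply: unif_continuous_pair; first by unif_cont_proj.
    by apply: cone_pt_continuous; [unif_cont_proj|exact: clampC].
  + apply: (unif_continuous_comp _ amalgam_inl_continuous).
    apply: unif_continuous_pair; last by unif_cont_proj.
    by apply: cone_pt_continuous; [unif_cont_proj|exact: clampC].
  + apply: (unif_continuous_comp _ amalgam_inl_continuous).
    apply: unif_continuous_pair; last by unif_cont_proj.
    apply: (unif_continuous_comp _ join_inl_continuous).
    by unif_cont_proj.
  + move=> w w0; rewrite clamp_le ?cone_pt_clampN1 //; lra.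
  + move=> w; rewrite -ltNge => w0.
    by rewrite clamp_le ?cone_pt_clampN1 ?amalgam_base //; lra.
- apply: (unif_continuous_comp _ amalgam_inr_continuous).
  by unif_cont_proj; exact: unif_continuous_cst.
- apply: (unif_continuous_comp _ amalgam_inl_continuous).
  by unif_cont_proj; exact: unif_continuous_cst.
Qed.

(** The height s of CX is carried to (s + 1) / 2, so the cone fills the upper
    half of the join. *)
Definition cone_prod_to_join (w : cone R X * Y) : join R X Y :=
  join_rec (fun x _ s => join_pt x w.2 (clamp (2^-1 * set_val s + 2^-1)))
    (fun x => join_pt x w.2 (clamp 0)) (fun _ => join_inr w.2) w.1.

(** The height s of CY is carried to - (s + 1) / 2: the orientation is
    reversed, since the apex of CY lies at the lower end of the join. *)
Definition prod_cone_to_join (w : X * cone R Y) : join R X Y :=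
  join_rec (fun y _ s => join_pt w.1 y (clamp (- 2^-1 * set_val s + - 2^-1)))
    (fun y => join_pt w.1 y (clamp 0)) (fun _ => join_inl w.1) w.2.

Section cone_prod_to_join.
Variable y : Y.

Let compat_base (x : X) (u : unit) (s : segment R) : set_val s = -1 ->
  join_pt x y (clamp (2^-1 * set_val s + 2^-1)) = join_pt x y (clamp 0).
Proof. by move=> ->; congr (join_pt x y (clamp _)); lra. Qed.

Let compat_apex (x : X) (u : unit) (s : segment R) : set_val s = 1 ->
  join_pt x y (clamp (2^-1 * set_val s + 2^-1)) = join_inr y.
Proof. by move=> ->; apply: join_pt_inr; rewrite val_clamp; lra. Qed.

Lemma cone_prod_to_join_pt x s : cone_prod_to_join (cone_pt x s, y) =
  join_pt x y (clamp (2^-1 * set_val s + 2^-1)).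
Proof. exact: (join_rec_pt compat_base compat_apex). Qed.

Lemma cone_prod_to_join_base x :
  cone_prod_to_join (cone_base R x, y) = join_pt x y (clamp 0).
Proof. exact: (join_rec_inl compat_base compat_apex). Qed.

Lemma cone_prod_to_join_apex : cone_prod_to_join (cone_apex, y) = join_inr y.
Proof. exact: (join_rec_inr compat_base compat_apex). Qed.

End cone_prod_to_join.

Section prod_cone_to_join.
Variable x : X.

Let compat_base (y : Y) (u : unit) (s : segment R) : set_val s = -1 ->
  join_pt x y (clamp (- 2^-1 * set_val s + - 2^-1)) = join_pt x y (clamp 0).
Proof. by move=> ->; congr (join_pt x y (clamp _)); lra. Qed.

Let compat_apex (y : Y) (u : unit) (s : segment R) : set_val s = 1 ->
  join_pt x y (clamp (- 2^-1 * set_val s + - 2^-1)) = join_inl x.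
Proof. by move=> ->; apply: join_pt_inl; rewrite val_clamp; lra. Qed.

Lemma prod_cone_to_join_pt y s : prod_cone_to_join (x, cone_pt y s) =
  join_pt x y (clamp (- 2^-1 * set_val s + - 2^-1)).
Proof. exact: (join_rec_pt compat_base compat_apex). Qed.

Lemma prod_cone_to_join_base y :
  prod_cone_to_join (x, cone_base R y) = join_pt x y (clamp 0).
Proof. exact: (join_rec_inl compat_base compat_apex). Qed.

Lemma prod_cone_to_join_apex : prod_cone_to_join (x, cone_apex) = join_inl x.
Proof. exact: (join_rec_inr compat_base compat_apex). Qed.

End prod_cone_to_join.

Lemma cone_prod_to_join_continuous : unif_continuous cone_prod_to_join.
Proof.
apply: cone_prod_unif_continuous.
- apply: (@eq_unif_continuous _ _ (fun w : X * segment R * Y =>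
    join_pt w.1.1 w.2 (clamp (2^-1 * set_val w.1.2 + 2^-1)))).
    by move=> [[x s] y] /=; rewrite cone_prod_to_join_pt.
  apply: join_pt_continuous; [by unif_cont_proj|by unif_cont_proj|].
  apply: (unif_continuous_comp _ (clamp_affine_unif_continuous _ _)).
  by unif_cont_proj.
- apply: eq_unif_continuous join_inr_continuous.
  by move=> y; rewrite cone_prod_to_join_apex.
Qed.

Lemma prod_cone_to_join_continuous : unif_continuous prod_cone_to_join.
Proof.
suff cswap : unif_continuous (fun w : cone R Y * X =>
    prod_cone_to_join (w.2, w.1)).
  apply: eq_unif_continuous (unif_continuous_comp
    (f := fun w : X * cone R Y => (w.2, w.1)) _ cswap).
    by move=> [x q].
  by unif_cont_proj.
apply: cone_prod_unif_continuous.
- apply: (@eq_unif_continuous _ _ (fun w : Y * segment R * X =>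
    join_pt w.2 w.1.1 (clamp (- 2^-1 * set_val w.1.2 + - 2^-1)))).
    by move=> [[y s] x] /=; rewrite prod_cone_to_join_pt.
  apply: join_pt_continuous; [by unif_cont_proj|by unif_cont_proj|].
  apply: (unif_continuous_comp _ (clamp_affine_unif_continuous _ _)).
  by unif_cont_proj.
- apply: eq_unif_continuous join_inl_continuous.
  by move=> x /=; rewrite prod_cone_to_join_apex.
Qed.

Definition amalgam_to_join : A -> join R X Y :=
  unif_lift (fun z => match z with
    | inl w => cone_prod_to_join w | inr w => prod_cone_to_join w end).

Let compat (z w : cone R X * Y + X * cone R Y) : glue z w ->
  match z with inl w => cone_prod_to_join w | inr w => prod_cone_to_join w end =
  match w with inl w => cone_prod_to_join w | inr w => prod_cone_to_join w end.
Proof.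
by case=> -[x y] /=; rewrite cone_prod_to_join_base prod_cone_to_join_base.
Qed.

Lemma amalgam_to_join_inl w :
  amalgam_to_join (amalgam_inl w) = cone_prod_to_join w.
Proof. by rewrite [LHS](unif_liftE compat). Qed.

Lemma amalgam_to_join_inr w :
  amalgam_to_join (amalgam_inr w) = prod_cone_to_join w.
Proof. by rewrite [LHS](unif_liftE compat). Qed.

Lemma amalgam_to_join_continuous : unif_continuous amalgam_to_join.
Proof.
apply: (unif_lift_continuous compat); apply: sum_unif_continuous.
- exact: cone_prod_to_join_continuous.
- exact: prod_cone_to_join_continuous.
Qed.

Lemma join_to_amalgamE :
  [/\ forall x y t, join_to_amalgam (join_pt x y t) = join_to_amalgam_pt x y t,
      forall x, join_to_amalgam (join_inl x) = amalgam_inr (x, cone_apex)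
    & forall y, join_to_amalgam (join_inr y) = amalgam_inl (cone_apex, y)].
Proof.
split=> [x y t|x|y].
- exact: (join_rec_pt join_to_amalgam_pt_inl join_to_amalgam_pt_inr).
- exact: (join_rec_inl join_to_amalgam_pt_inl join_to_amalgam_pt_inr).
- exact: (join_rec_inr join_to_amalgam_pt_inl join_to_amalgam_pt_inr).
Qed.

Lemma join_to_amalgamK : cancel join_to_amalgam amalgam_to_join.
Proof.
have [Ept El Er] := join_to_amalgamE.
apply: join_ind => [x y t|x|y].
- have /andP[t1 t2] := segment_bounds t.
  rewrite Ept /join_to_amalgam_pt; case: lerP => t0.
  + rewrite amalgam_to_join_inr prod_cone_to_join_pt val_clamp; last lra.
    by rewrite -[in RHS](clamp_val t); congr (join_pt x y (clamp _)); lra.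
  + rewrite amalgam_to_join_inl cone_prod_to_join_pt val_clamp; last lra.
    by rewrite -[in RHS](clamp_val t); congr (join_pt x y (clamp _)); lra.
- by rewrite El amalgam_to_join_inr prod_cone_to_join_apex.
- by rewrite Er amalgam_to_join_inl cone_prod_to_join_apex.
Qed.

Lemma amalgam_to_joinK : cancel amalgam_to_join join_to_amalgam.
Proof.
have [Ept El Er] := join_to_amalgamE.
move=> q; have [[[p y]|[x p]] ->] := unif_proj_surj q.
- rewrite -[unif_proj _ _]/(amalgam_inl (p, y)) amalgam_to_join_inl.
  have [[x [s ->]]| ->] := cone_cases p; last by rewrite cone_prod_to_join_apex.
  have /andP[s1 s2] := segment_bounds s.
  rewrite cone_prod_to_join_pt Ept /join_to_amalgam_pt val_clamp; last lra.
  case: lerP => s0.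
    (* The formula of the lower half is selected only on the common base. *)
    have s_base : set_val s = -1 by lra.
    rewrite (cone_pt_base x s_base) amalgam_base s_base.
    by rewrite clamp_le ?cone_pt_clampN1 //; lra.
  rewrite -[in RHS](clamp_val s).
  by congr (amalgam_inl (cone_pt x (clamp _), y)); lra.
- rewrite -[unif_proj _ _]/(amalgam_inr (x, p)) amalgam_to_join_inr.
  have [[y [s ->]]| ->] := cone_cases p; last by rewrite prod_cone_to_join_apex.
  have /andP[s1 s2] := segment_bounds s.
  rewrite prod_cone_to_join_pt Ept /join_to_amalgam_pt val_clamp; last lra.
  rewrite ifT; last lra.
  rewrite -[in RHS](clamp_val s).
  by congr (amalgam_inr (x, cone_pt y (clamp _))); lra.
Qed.

End join_amalgam.

Theorem lemma11p1 (R : realType) (X Y : uniformType)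
    (hX : metrizable R X) (hY : metrizable R Y) :
  unif_homeomorphic (join R X Y)
    (@amalgam (X * Y)%type (cone R X * Y)%type (X * cone R Y)%type
      (fun xy : X * Y => (cone_base R xy.1, xy.2))
      (fun xy : X * Y => (xy.1, cone_base R xy.2))).
Proof.
exists join_to_amalgam, amalgam_to_join; split.
- exact: join_to_amalgamK.
- exact: amalgam_to_joinK.
- exact: join_to_amalgam_continuous.
- exact: amalgam_to_join_continuous.
Qed.
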